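(* Let $(X,p,E)$ be an $op$-continuous and $p$-complete lattice-normed vector lattice, where $E$ is an order continuous Banach lattice, and let $(x_\alpha)$ be a net in $X$ with $x_\alpha\xrightarrow{up}0$. Then there exist an increasing sequence $(\alpha_k)$ of indices and a disjoint sequence $(d_k)$ in $X$ such that $(x_{\alpha_k}-d_k)\xrightarrow{p}0$ as $k\to\infty$.
   Context: All vector lattices are real and Archimedean. A net $(x_\alpha)$ in a vector lattice is order convergent to $x$ ($x_\alpha\xrightarrow{o}x$) if there is a net $(y_\beta)$ (possibly with a different index set) with $y_\beta\downarrow 0$ such that for each $\beta$ there is $\alpha_\beta$ with $|x_\alpha-x|\le y_\beta$ for all $\alpha\ge\alpha_\beta$. A lattice-normed vector lattice (LNVL) is a triple $(X,p,E)$, where $X$ and $E$ are vector lattices and $p:X\to E_+$ satisfies: $p(x)=0\Leftrightarrow x=0$; $p(\lambda x)=|\lambda|p(x)$; $p(x+y)\le p(x)+p(y)$; and $|x|\le|y|\Rightarrow p(x)\le p(y)$. A net $x_\alpha$ $p$-converges to $x$ ($x_\alpha\xrightarrow{p}x$) if $p(x_\alpha-x)\xrightarrow{o}0$ in $E$; it $up$-converges to $x$ ($x_\alpha\xrightarrow{up}x$) if $p(|x_\alpha-x|\wedge u)\xrightarrow{o}0$ in $E$ for every $u\in X_+$. A net $(x_\alpha)_{\alpha\in A}$ is $p$-Cauchy if $(x_\alpha-x_{\alpha'})_{(\alpha,\alpha')\in A\times A}$ $p$-converges to $0$; $X$ is $p$-complete if every $p$-Cauchy net is $p$-convergent. $X$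 is $op$-continuous if $x_\alpha\xrightarrow{o}0$ in $X$ implies $p(x_\alpha)\xrightarrow{o}0$ in $E$. A sequence $(d_k)$ is disjoint if $|d_k|\wedge|d_l|=0$ for $k\ne l$. A Banach lattice is order continuous if $x_\alpha\downarrow0$ implies $\lVert x_\alpha\rVert\to0$. *)

(* Defs.v *)
From HB Require Import structures.
From mathcomp Require Import all_boot all_order all_algebra.
From mathcomp Require Import all_classical all_reals all_analysis.

Set Implicit Arguments.
Unset Strict Implicit.
Unset Printing Implicit Defensive.

Import Order.TTheory GRing.Theory Num.Theory.
Import numFieldNormedType.Exports.
Local Open Scope classical_set_scope.
Local Open Scope ring_scope.

(* Real Archimedean vector lattices: ordered vector spaces in which any two
   elements have a supremum and an infimum and, for 0 <= x, the infimum of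
   the elements x/(n+1) is 0.  Order.Lattice cannot be inherited: HB rejects
   a join of Order.Lattice and GRing.Zmodule that is not an ancestor of
   Num.RealDomain. *)
HB.mixin Record isVectorLattice (R : realType) X
    & GRing.Lmodule R X & Num.POrderedZmodule X := {
  vl_leD2r : forall z x y : X, x <= y -> x + z <= y + z;
  vl_scale_ge0 : forall (a : R) (x : X), 0 <= a -> 0 <= x -> 0 <= a *: x;
  vsup : X -> X -> X;
  vinf : X -> X -> X;
  vsup_le : forall x y z : X, (vsup x y <= z) = (x <= z) && (y <= z);
  le_vinf : forall x y z : X, (z <= vinf x y) = (z <= x) && (z <= y);
  vl_archimedean : forall x y : X,
    0 <= x -> (forall n : nat, y <= n.+1%:R^-1 *: x) -> y <= 0
}.

#[short(type="vectorLatticeType")]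
HB.structure Definition VectorLattice (R : realType) :=
  {X of GRing.Lmodule R X & Num.POrderedZmodule X & isVectorLattice R X}.

Definition vabs (R : realType) (X : vectorLatticeType R) (x : X) : X :=
  vsup x (- x).

(* For the same reason the norm is a field of the mixin: HB rejects a join of
   Order.POrder and CompleteNormedModule that is not an ancestor of
   Num.NumDomain. *)
HB.mixin Record isBanachLattice (R : realType) E & VectorLattice R E := {
  bnorm : E -> R;
  bnorm_eq0 : forall x : E, bnorm x = 0 -> x = 0;
  bnormZ : forall (a : R) (x : E), bnorm (a *: x) = `|a| * bnorm x;
  bnormD : forall x y : E, bnorm (x + y) <= bnorm x + bnorm y;
  bnorm_mono : forall x y : E, vabs x <= vabs y -> bnorm x <= bnorm y;
  bnorm_complete : forall u : nat -> E,
    (forall e : R, 0 < e -> exists N : nat, forall m n : nat,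
      (N <= m)%N -> (N <= n)%N -> bnorm (u m - u n) < e) ->
    exists l : E, bnorm (u n - l) @[n --> \oo] --> (0 : R)
}.

#[short(type="banachLatticeType")]
HB.structure Definition BanachLattice (R : realType) :=
  {E of VectorLattice R E & isBanachLattice R E}.

(* Directed preordered sets, the index sets of nets. *)
Record directedSet := DirectedSet {
  dset :> Type;
  dle : dset -> dset -> Prop;
  dset_inhabited : inhabited dset;
  dle_refl : forall a, dle a a;
  dle_trans : forall b a c, dle a b -> dle b c -> dle a c;
  dle_directed : forall a b, exists c, dle a c /\ dle b c
}.

Lemma nat_directed_ub (m n : nat) : exists k, (m <= k)%N /\ (n <= k)%N.
Proof. by exists (maxn m n); rewrite leq_maxl leq_maxr. Qed.

Definition nat_directed : directedSet :=
  @DirectedSet nat (fun m n => (m <= n)%N) (inhabits 0%N) leqnn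
    (fun n m k => @leq_trans n m k) nat_directed_ub.

Section ProdDirected.
Variables A B : directedSet.

Definition prod_dle (a b : A * B) : Prop := dle a.1 b.1 /\ dle a.2 b.2.

Lemma prod_dset_inhabited : inhabited (A * B).
Proof. by case: (dset_inhabited A) (dset_inhabited B) => a [b]. Qed.

Lemma prod_dle_refl a : prod_dle a a.
Proof. by split; apply: dle_refl. Qed.

Lemma prod_dle_trans b a c : prod_dle a b -> prod_dle b c -> prod_dle a c.
Proof.
by move=> [ab1 ab2] [bc1 bc2]; split; [apply: dle_trans bc1|apply: dle_trans bc2].
Qed.

Lemma prod_dle_directed a b : exists c, prod_dle a c /\ prod_dle b c.
Proof.
have [c1 [ac1 bc1]] := dle_directed a.1 b.1.
have [c2 [ac2 bc2]] := dle_directed a.2 b.2.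
by exists (c1, c2).
Qed.

Definition prod_directed : directedSet :=
  DirectedSet prod_dset_inhabited prod_dle_refl prod_dle_trans prod_dle_directed.

End ProdDirected.

(* The filter along which nets indexed by A converge. *)
Definition tails (A : directedSet) : set_system (dset A) :=
  [set S | exists a, forall b, dle a b -> S b].
Arguments tails A _ : clear implicits.

#[global] Instance tails_filter (A : directedSet) : ProperFilter (tails A).
Proof.
split; first by move=> [a]; apply; exact: dle_refl.
split.
- by case: (dset_inhabited A) => a; exists a.
- move=> P Q [a aP] [b bQ]; have [c [ac bc]] := dle_directed a b.
  by exists c => d cd; split; [apply: aP|apply: bQ]; apply: dle_trans cd.
- by move=> P Q PQ [a aP]; exists a => b /aP /PQ.
Qed.

Section Convergence.
Variables (R : realType).

Definition decreases_to0 (X : vectorLatticeType R) (A : directedSet)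
    (y : A -> X) : Prop :=
  [/\ forall a b, dle a b -> y b <= y a,
      forall a, 0 <= y a
    & forall z, (forall a, z <= y a) -> z <= 0].

Definition o_cvg (X : vectorLatticeType R) (A : directedSet)
    (x : A -> X) (l : X) : Prop :=
  exists (B : directedSet) (y : B -> X), decreases_to0 y /\
    forall b, exists a0, forall a, dle a0 a -> vabs (x a - l) <= y b.

Record lattice_norm (X E : vectorLatticeType R) (p : X -> E) : Prop := {
  ln_ge0 : forall x, 0 <= p x;
  ln_eq0 : forall x, p x = 0 <-> x = 0;
  lnZ : forall (a : R) x, p (a *: x) = `|a| *: p x;
  lnD : forall x y, p (x + y) <= p x + p y;
  ln_mono : forall x y, vabs x <= vabs y -> p x <= p y
}.

Section LatticeNorm.
Variables (X E : vectorLatticeType R) (p : X -> E).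

Definition p_cvg (A : directedSet) (x : A -> X) (l : X) : Prop :=
  @o_cvg E A (fun a => p (x a - l)) 0.

Definition up_cvg (A : directedSet) (x : A -> X) (l : X) : Prop :=
  forall u : X, 0 <= u -> @o_cvg E A (fun a => p (vinf (vabs (x a - l)) u)) 0.

Definition p_cauchy (A : directedSet) (x : A -> X) : Prop :=
  @p_cvg (prod_directed A A) (fun a : A * A => x a.1 - x a.2) 0.

Definition p_complete : Prop :=
  forall (A : directedSet) (x : A -> X), p_cauchy x -> exists l, p_cvg x l.

Definition op_continuous : Prop :=
  forall (A : directedSet) (x : A -> X),
    o_cvg x 0 -> @o_cvg E A (fun a => p (x a)) 0.

End LatticeNorm.

Definition disjoint_seq (X : vectorLatticeType R) (d : nat -> X) : Prop :=
  forall k l, k <> l -> vinf (vabs (d k)) (vabs (d l)) = 0.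

Definition order_continuous (E : banachLatticeType R) : Prop :=
  forall (A : directedSet) (x : A -> E),
    decreases_to0 x -> bnorm (x a) @[a --> tails A] --> (0 : R).

End Convergence.

(* Main.v *)
(* Choose indices so that the overlaps w_k = |x_{alpha_k}| /\ sum_(i<k)
   |x_{alpha_i}| have ||p(w_k)|| <= 4^-(k+1).  Then u = sum_k 2^(k+1) p(w_k)
   exists in E and p(w_k) <= 2^-(k+1) u, so the series of the w_k is p-Cauchy;
   let v_k be its k-th tail.  Every overlap |x_{alpha_k}| /\ |x_{alpha_l}| with
   k <> l is below both v_k and v_l, so the truncations of x_{alpha_k} at height
   v_k leave pairwise disjoint remainders d_k, while the truncated parts are
   bounded by v_k, and p(v_k) order converges to 0. *)
Require Import Defs.
From mathcomp Require Import all_boot all_order all_algebra.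
From mathcomp Require Import all_classical all_reals all_analysis.

Set Implicit Arguments.
Unset Strict Implicit.
Unset Printing Implicit Defensive.

Import Order.TTheory GRing.Theory Num.Theory.
Import numFieldNormedType.Exports.
Local Open Scope classical_set_scope.
Local Open Scope ring_scope.

(** * Order, lattice and absolute value inequalities in a vector lattice *)

Section VectorLatticeTheory.
Variables (R : realType) (X : vectorLatticeType R).
Implicit Types x y z v m : X.

Lemma vl_leDl z x y : (x + z <= y + z) = (x <= y).
Proof.
apply/idP/idP => [h|]; last exact: vl_leD2r.
by rewrite -(addrK z x) -(addrK z y) vl_leD2r.
Qed.

Lemma vl_leD x y z v : x <= y -> z <= v -> x + z <= y + v.
Proof.
move=> xy zv; apply: le_trans (vl_leD2r _ _ _ xy) _.
by rewrite ![y + _]addrC vl_leD2r.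
Qed.

Lemma vl_subr_ge0 x y : (0 <= y - x) = (x <= y).
Proof. by rewrite -(vl_leDl x 0) add0r subrK. Qed.

Lemma vl_leBlr x y z : (x - y <= z) = (x <= z + y).
Proof. by rewrite -(vl_leDl y (x - y)) subrK. Qed.

Lemma vl_leBC x y z : (x - y <= z) = (x - z <= y).
Proof. by rewrite !vl_leBlr addrC. Qed.

Lemma vl_leBl x y : (x - y <= x) = (0 <= y).
Proof. by rewrite vl_leBC subrr. Qed.

Lemma vl_leN x y : (- x <= - y) = (y <= x).
Proof. by rewrite -(vl_leDl (x + y) (- x)) addKr addrC addrK. Qed.

Lemma vl_oppr_le0 x : (- x <= 0) = (0 <= x).
Proof. by rewrite -{1}oppr0 vl_leN. Qed.

Lemma vl_leZl (a : R) x y : 0 <= a -> x <= y -> a *: x <= a *: y.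
Proof.
by move=> a0 xy; rewrite -vl_subr_ge0 -scalerBr vl_scale_ge0 // vl_subr_ge0.
Qed.

Lemma vl_leZr (a b : R) x : 0 <= x -> a <= b -> a *: x <= b *: x.
Proof.
by move=> x0 ab; rewrite -vl_subr_ge0 -scalerBl vl_scale_ge0 // subr_ge0.
Qed.

Lemma vl_sum_ge0 (I : Type) (r : seq I) (P : pred I) (F : I -> X) :
  (forall i, P i -> 0 <= F i) -> 0 <= \sum_(i <- r | P i) F i.
Proof.
move=> F0; elim/big_ind: _ => // y z y0 z0.
by rewrite -[0]addr0 vl_leD.
Qed.

Lemma le_sum_nat_term (F : nat -> X) (m n k : nat) :
  (forall i, 0 <= F i) -> (m <= k < n)%N -> F k <= \sum_(m <= i < n) F i.
Proof.
move=> F0 /andP[mk kn].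
rewrite (bigD1_seq k) ?mem_index_iota ?mk ?iota_uniq //=.
by rewrite -{1}[F k]addr0 vl_leD // vl_sum_ge0.
Qed.

Lemma le_vsupl x y : x <= vsup x y.
Proof. by have := vsup_le x y (vsup x y); rewrite lexx => /esym/andP[]. Qed.

Lemma le_vsupr x y : y <= vsup x y.
Proof. by have := vsup_le x y (vsup x y); rewrite lexx => /esym/andP[]. Qed.

Lemma vinf_lel x y : vinf x y <= x.
Proof. by have := le_vinf x y (vinf x y); rewrite lexx => /esym/andP[]. Qed.

Lemma vinf_ler x y : vinf x y <= y.
Proof. by have := le_vinf x y (vinf x y); rewrite lexx => /esym/andP[]. Qed.

Lemma vinfC x y : vinf x y = vinf y x.
Proof. by apply/le_anti; rewrite !le_vinf !vinf_lel !vinf_ler. Qed.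

Lemma vinf_mono x y z v : x <= y -> z <= v -> vinf x z <= vinf y v.
Proof.
by move=> xy zv; rewrite le_vinf (le_trans (vinf_lel _ _) xy)
  (le_trans (vinf_ler _ _) zv).
Qed.

Lemma vabs_le x y : (vabs x <= y) = (x <= y) && (- x <= y).
Proof. exact: vsup_le. Qed.

Lemma ler_vabs x : x <= vabs x. Proof. exact: le_vsupl. Qed.

Lemma lerN_vabs x : - x <= vabs x. Proof. exact: le_vsupr. Qed.

(** Adding [x <= vabs x] and [- x <= vabs x] gives [0 <= 2 *: vabs x], and halving preserves the
    order. *)
Lemma vabs_ge0 x : 0 <= vabs x.
Proof.
have h : 0 <= vabs x + vabs x.
  by rewrite -(subrr x) vl_leD // ?ler_vabs ?lerN_vabs.
have -> : vabs x = 2^-1 *: (vabs x + vabs x).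
  by rewrite -mulr2n -(scaler_nat 2 (vabs x)) scalerA mulVf ?scale1r// pnatr_eq0.
by rewrite vl_scale_ge0 // invr_ge0.
Qed.

Lemma vabsN x : vabs (- x) = vabs x.
Proof.
have le y : vabs (- y) <= vabs y by rewrite vabs_le opprK lerN_vabs ler_vabs.
by apply/le_anti; rewrite le -{1}[x]opprK le.
Qed.

Lemma ger0_vabs x : 0 <= x -> vabs x = x.
Proof.
move=> x0; apply/le_anti; rewrite ler_vabs vabs_le lexx andbT /=.
by apply: le_trans (x0); rewrite vl_oppr_le0.
Qed.

(** For [0 <= v] this is the truncation of [x] to the order interval from [- v] to [v]; what it
    removes has absolute value equal to the positive part of [vabs x - v]. *)
Definition vclip x v := vsup (vinf x v) (- v).

Lemma vabs_vclip_le x v : 0 <= v -> vabs (vclip x v) <= v.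
Proof.
move=> v0; rewrite vabs_le vsup_le vinf_ler /=; apply/andP; split.
  by apply: le_trans (v0); rewrite vl_oppr_le0.
by rewrite -[leRHS]opprK vl_leN le_vsupr.
Qed.

Lemma vabs_sub_vclip_le x v m :
  m <= v -> m <= vabs x -> vabs (x - vclip x v) <= vabs x - m.
Proof.
move=> mv mx.
(* Only these two bounds on [vabs x - m] matter: it lies above the positive part of [vabs x - v]. *)
have [e0 vxe] : 0 <= vabs x - m /\ vabs x - v <= vabs x - m.
  by rewrite vl_subr_ge0 vl_leD // vl_leN.
move: (vabs x - m) e0 vxe => e e0 vxe.
rewrite vabs_le opprB vl_leBC !vl_leBlr; apply/andP; split.
  rewrite -vl_leBlr; apply: le_trans (le_vsupl _ _).
  rewrite le_vinf vl_leBl e0 vl_leBC /=; apply: le_trans vxe.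
  by rewrite vl_leD2r // ler_vabs.
rewrite vsup_le -!vl_leBlr; apply/andP; split.
  by apply: le_trans e0; rewrite vl_leBlr add0r vinf_lel.
by rewrite addrC; apply: le_trans vxe; rewrite vl_leD2r // lerN_vabs.
Qed.

(** The remainders are at most [vabs x - m] and [vabs y - m]. If [z] is their infimum, then [z + m]
    is below both absolute values, hence below their infimum [m], so [z <= 0]. *)
Lemma vinf_remainders_eq0 x y v w m :
  m <= v -> m <= w -> m = vinf (vabs x) (vabs y) ->
  vinf (vabs (x - vclip x v)) (vabs (y - vclip y w)) = 0.
Proof.
move=> mv mw em; apply/le_anti; rewrite le_vinf !vabs_ge0 /= andbT.
set z := vinf _ _.
have zx : z <= vabs x - m.
  by rewrite (le_trans (vinf_lel _ _)) // vabs_sub_vclip_le // em vinf_lel.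
have zy : z <= vabs y - m.
  by rewrite (le_trans (vinf_ler _ _)) // vabs_sub_vclip_le // em vinf_ler.
rewrite -(vl_leDl m) add0r {2}em le_vinf.
by rewrite -(subrK m (vabs x)) -(subrK m (vabs y)) !vl_leDl zx.
Qed.

(** * Order convergence to 0 *)

Lemma dominated_o_cvg0 (A : directedSet) (f g : A -> X) :
  (forall i, 0 <= f i <= g i) -> o_cvg g 0 -> o_cvg f 0.
Proof.
move=> fg [B [y [y0 gy]]]; exists B, y; split=> // b.
have [a0 ga] := gy b; exists a0 => a /ga; apply: le_trans; rewrite !subr0.
have /andP[f0 fga] := fg a; rewrite !ger0_vabs //.
exact: le_trans fga.
Qed.

Lemma o_cvg0_le0 (A : directedSet) (f : A -> X) (c : X) :
  o_cvg f 0 -> (exists a0, forall a, dle a0 a -> c <= f a) -> c <= 0.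
Proof.
move=> [B [y [[_ _ yinf] fy]]] [a0 ca]; apply: yinf => b.
have [a1 fa] := fy b; have [a [a0a a1a]] := dle_directed a0 a1.
apply: le_trans (ca a a0a) _; apply: le_trans (fa a a1a).
by rewrite subr0 ler_vabs.
Qed.

Lemma geometric_decreases_to0 (u : X) : 0 <= u ->
  @decreases_to0 R X nat_directed (fun n => 2^-1 ^+ n *: u).
Proof.
move=> u0; split=> [i j ij|i|z zu].
- apply: vl_leZr => //; apply: ler_wiXn2l => //.
  by rewrite invf_le1 // ler1n.
- by rewrite vl_scale_ge0 // exprn_ge0 // invr_ge0.
(* The Archimedean bound [n.+1%:R^-1 *: u] follows from the term of index [n.+1], since
   [n.+1 < 2 ^ n.+1]. *)
- apply: (vl_archimedean _ _ u0) => n; apply: le_trans (zu n.+1) _.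
  apply: vl_leZr => //; rewrite exprVn lef_pV2 ?posrE ?exprn_gt0 ?ltr0n //.
  by rewrite -natrX ler_nat ltnW // ltn_expl.
Qed.

End VectorLatticeTheory.

(** * Lattice norms, p-limits and geometric series *)

Section LatticeNormTheory.
Variables (R : realType) (X E : vectorLatticeType R) (p : X -> E).
Hypothesis p_norm : lattice_norm p.

Lemma lnorm0 : p 0 = 0.
Proof. exact/(Defs.ln_eq0 p_norm). Qed.

Lemma lnormBC (x y : X) : p (x - y) = p (y - x).
Proof.
by apply/le_anti; rewrite !(ln_mono p_norm) // -vabsN opprB.
Qed.

(** Eventually the positive part of [z - l] is below [vabs (f a - l)]. Its norm is thus a constant
    below an order null net, so it vanishes. *)
Lemma p_cvg_ge (A : directedSet) (f : A -> X) (l z : X) :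
  p_cvg p f l -> (exists a0, forall a, dle a0 a -> z <= f a) -> z <= l.
Proof.
move=> fl [a0 zf].
have /eqP : p (vsup (z - l) 0) = 0.
  apply/le_anti/andP; split; last exact: Defs.ln_ge0.
  apply: (o_cvg0_le0 fl); exists a0 => a /zf zfa.
  apply: (ln_mono p_norm); rewrite ger0_vabs ?le_vsupr // vsup_le vabs_ge0 andbT.
  by apply: le_trans (ler_vabs _); rewrite vl_leD2r.
move=> /eqP/(Defs.ln_eq0 p_norm) zl.
by rewrite -vl_subr_ge0 -opprB -vl_oppr_le0 opprK -[leRHS]zl le_vsupl.
Qed.

(** The bounds telescope: [2^-1 ^+ k.+1] is [2^-1 ^+ k - 2^-1 ^+ k.+1]. *)
Lemma lnorm_sum_geometric (w : nat -> X) (u : E) m n :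
  (forall k, p (w k) <= 2^-1 ^+ k.+1 *: u) -> (m <= n)%N ->
  p (\sum_(m <= i < n) w i) <= (2^-1 ^+ m - 2^-1 ^+ n) *: u.
Proof.
move=> wu /subnKC <-; elim: (n - m)%N => [|j IH].
  by rewrite addn0 big_geq // lnorm0 subrr scale0r.
rewrite addnS big_nat_recr ?leq_addr //=.
apply: le_trans (lnD p_norm _ _) _; apply: le_trans (vl_leD IH (wu _)) _.
rewrite -scalerDl; set c := (X in X *: u); set d := (X in _ <= X *: u).
suff -> : c = d by [].
rewrite {}/c {}/d -addrA; congr (_ + _); rewrite exprS.
by rewrite {1}[2^-1 ^+ (m + j)]splitr mulrC opprD addrNK.
Qed.

Lemma p_complete_geometric_series (w : nat -> X) (u : E) :
  p_complete p -> 0 <= u -> (forall k, p (w k) <= 2^-1 ^+ k.+1 *: u) ->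
  exists s, @p_cvg _ _ _ p nat_directed (fun n => \sum_(0 <= i < n) w i) s.
Proof.
move=> p_comp u0 wu; apply: p_comp.
(* The Cauchy net is indexed by pairs, but a dominating net indexed by [nat] suffices: beyond
   [(N, N)] the differences have norm at most [2^-1 ^+ N *: u]. *)
exists nat_directed, (fun n => 2^-1 ^+ n *: u).
split; first exact: geometric_decreases_to0.
move=> N; exists (N, N) => -[m n] [/= Nm Nn].
rewrite !subr0 ger0_vabs; last exact: Defs.ln_ge0.
have aux i j : (N <= i)%N -> (i <= j)%N ->
    p (\sum_(0 <= k < j) w k - \sum_(0 <= k < i) w k) <= 2^-1 ^+ N *: u.
  move=> Ni ij; rewrite (big_cat_nat (leq0n i) ij) /= addrAC subrr add0r.
  apply: le_trans (lnorm_sum_geometric wu ij) _; apply: vl_leZr => //.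
  rewrite lerBlDr -[leLHS]addr0 lerD // ?exprn_ge0 ?invr_ge0 //.
  by apply: ler_wiXn2l => //; rewrite ?invr_ge0 // invf_le1 // ler1n.
have [mn|/ltnW nm] := leqP m n; last exact: aux.
by rewrite lnormBC; exact: aux.
Qed.

End LatticeNormTheory.

(** * Norm limits and order continuity in Banach lattices *)

Section BanachLatticeTheory.
Variables (R : realType) (E : banachLatticeType R).
Implicit Types x y : E.

Lemma bnorm0 : bnorm (0 : E) = 0.
Proof. by rewrite -(scale0r (0 : E)) bnormZ normr0 mul0r. Qed.

Lemma bnormN x : bnorm (- x) = bnorm x.
Proof. by rewrite -scaleN1r bnormZ normrN1 mul1r. Qed.

Lemma bnorm_ge0 x : 0 <= bnorm x.
Proof.
have := bnormD x (- x); rewrite subrr bnorm0 bnormN -mulr2n.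
by rewrite pmulrn_lge0.
Qed.

Lemma bnorm_lim_ge (s : nat -> E) (l z : E) :
  bnorm (s n - l) @[n --> \oo] --> (0 : R) ->
  (\forall n \near \oo, z <= s n) -> z <= l.
Proof.
move=> sl zs.
have /bnorm_eq0 zl : bnorm (vsup (z - l) 0) = 0.
  apply/le_anti; rewrite bnorm_ge0 andbT.
  apply: (cvgr_to_ge sl); near=> n.
  apply: bnorm_mono; rewrite ger0_vabs ?le_vsupr // vsup_le vabs_ge0 andbT.
  apply: le_trans (ler_vabs _); rewrite vl_leD2r //.
  by near: n.
by rewrite -vl_subr_ge0 -opprB -vl_oppr_le0 opprK -[leRHS]zl le_vsupl.
Unshelve. all: by end_near. Qed.

(** Order continuity speaks of decreasing nets, so it is applied to the net dominating [f];
    monotonicity of the norm transfers the bound. *)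
Lemma order_continuous_bnorm_lt (A : directedSet) (f : A -> E) (e : R) :
  order_continuous E -> o_cvg f 0 -> 0 < e ->
  exists a0, forall a, dle a0 a -> bnorm (f a) < e.
Proof.
move=> oc [B [y [y0 fy]]] e0.
have /cvgr0Pnorm_lt/(_ e e0) [b yb] := oc _ _ y0.
have [a0 fa] := fy b; exists a0 => a /fa fay.
apply: le_lt_trans (le_lt_trans (ler_norm _) (yb b (dle_refl b))).
apply: bnorm_mono; rewrite subr0 in fay.
exact: le_trans fay (ler_vabs _).
Qed.

(** Take [u] to be the sum of the weighted terms [c k]: their norms are at most [2^-1 ^+ k.+1], so
    the series converges in norm, and positivity puts each term below the sum. *)
Lemma geometric_dominant (b : nat -> E) :
  (forall k, 0 <= b k) -> (forall k, bnorm (b k) <= 4^-1 ^+ k.+1) ->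
  exists2 u : E, 0 <= u & forall k, b k <= 2^-1 ^+ k.+1 *: u.
Proof.
move=> b0 bn; pose c k := 2 ^+ k.+1 *: b k.
have h0 : 0 <= 2^-1 :> R by rewrite invr_ge0.
have c0 k : 0 <= c k by rewrite vl_scale_ge0 // exprn_ge0.
have cn k : bnorm (c k) <= 2^-1 ^+ k.+1.
  rewrite bnormZ ger0_norm ?exprn_ge0 //.
  apply: le_trans (ler_wpM2l _ (bn k)) _; first by rewrite exprn_ge0.
  rewrite -exprMn (_ : 2 * 4^-1 = 2^-1) //.
  by rewrite (natrM _ 2 2) invfM mulrA divff ?mul1r // pnatr_eq0.
have sn m n : (m <= n)%N ->
    bnorm (\sum_(m <= i < n) c i) <= 2^-1 ^+ m - 2^-1 ^+ n.
  move=> /subnKC <-; elim: (n - m)%N => [|j IH].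
    by rewrite addn0 big_geq // bnorm0 subrr.
  rewrite addnS big_nat_recr ?leq_addr //=.
  apply: le_trans (bnormD _ _) _; apply: le_trans (lerD IH (cn _)) _.
  rewrite -addrA lerD2l exprS.
  by rewrite {1}[2^-1 ^+ (m + j)]splitr mulrC opprD addrNK.
have [|l sl] := @bnorm_complete _ E (fun n => \sum_(0 <= i < n) c i).
  move=> e e0.
  have : (2^-1 : R) ^+ n @[n --> \oo] --> (0 : R).
    by apply: cvg_expr; rewrite ger0_norm // invf_lt1 // ltr1n.
  move=> /cvgr0Pnorm_lt/(_ e e0) [N _ Ne]; exists N.
  have aux i j : (N <= i)%N -> (i <= j)%N ->
      bnorm (\sum_(0 <= k < j) c k - \sum_(0 <= k < i) c k) < e.
    move=> Ni ij; rewrite (big_cat_nat (leq0n i) ij) /= addrAC subrr add0r.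
    apply: le_lt_trans (sn _ _ ij) _; apply: le_lt_trans (Ne i Ni).
    by rewrite (le_trans _ (ler_norm _)) // lerBlDr lerDl exprn_ge0.
  move=> m n Nm Nn; have [mn|/ltnW nm] := leqP m n; last exact: aux.
  by rewrite -bnormN opprB; exact: aux.
have cl k : c k <= l.
  apply: (bnorm_lim_ge sl); exists k.+1 => // n /= kn.
  by apply: le_sum_nat_term => //.
exists l => [|k]; first exact: le_trans (c0 0%N) (cl 0%N).
apply: le_trans (vl_leZl _ (cl k)); last by rewrite exprn_ge0.
by rewrite scalerA -exprMn mulVf ?expr1n ?scale1r // pnatr_eq0.
Qed.

End BanachLatticeTheory.

(** * Recursive choice of indices with small overlaps *)

Lemma up_null_small_overlaps (R : realType) (X : vectorLatticeType R)
    (E : banachLatticeType R) (p : X -> E) (A : directedSet) (x : A -> X)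
    (e : nat -> R) :
  lattice_norm p -> order_continuous E -> up_cvg p x 0 ->
  (forall k, 0 < e k) ->
  exists alpha : nat -> A,
    (forall k l, (k <= l)%N -> dle (alpha k) (alpha l)) /\
    forall k, bnorm (p (vinf (vabs (x (alpha k)))
                             (\sum_(0 <= i < k) vabs (x (alpha i))))) <= e k.
Proof.
move=> p_norm oc x_up e0.
(* The triple holds the stage, the previous index and the accumulated sum. Positivity of the sum is
   a premise of the bound, so that the choice function is defined on all triples. *)
have step (t : nat * A * X) : exists b : A, dle t.1.2 b /\
    (0 <= t.2 -> bnorm (p (vinf (vabs (x b)) t.2)) <= e t.1.1).
  case: t => -[k a] S /=; have [S0|nS0] := pselect (0 <= S); last first.
    by exists a; split; first exact: dle_refl.
  have [b0 b0P] := order_continuous_bnorm_lt oc (x_up _ S0) (e0 k).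
  have [b [ab b0b]] := dle_directed a b0.
  by exists b; split=> // _; have := b0P b b0b; rewrite subr0 => /ltW.
have [f fP] := choice step.
have [a0] := dset_inhabited A.
(* The second component of [st n] sums over the indices before stage [n] only; it is the very vector
   against which the index of stage [n] is chosen. *)
pose st := fix st n : A * X := if n is k.+1
  then let S := (st k).2 + vabs (x (st k).1) in (f (k.+1, (st k).1, S), S)
  else (f (0%N, a0, 0), 0).
have stS k : (st k).2 = \sum_(0 <= i < k) vabs (x (st i).1).
  by elim: k => [|k IH] /=; [rewrite big_geq|rewrite big_nat_recr //= IH].
exists (fun k => (st k).1); split=> [k l|k].
  move=> /subnKC <-; elim: (l - k)%N => [|j IH].
    by rewrite addn0; exact: dle_refl.
  by rewrite addnS; apply: dle_trans IH _; exact: (fP (_, _, _)).1.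
rewrite -stS; have S0 n : 0 <= (st n).2.
  by rewrite stS vl_sum_ge0 // => i _; exact: vabs_ge0.
case: k => [|k]; first exact: ((fP (_, _, _)).2 (lexx _)).
exact: ((fP (_, _, _)).2 (S0 k.+1)).
Qed.

(* Construction of the disjoint sequence *)
Local Close Scope classical_set_scope.
Unset Implicit Arguments.

Theorem theorem5p6 (R : realType) (X : vectorLatticeType R)
    (E : banachLatticeType R) (p : X -> E)
    (p_norm : lattice_norm p)
    (p_opcont : op_continuous p)
    (p_comp : p_complete p)
    (E_ocont : order_continuous E)
    (A : directedSet) (x : A -> X)
    (x_up : up_cvg p x 0) :
  exists (alpha : nat -> A) (d : nat -> X),
    [/\ forall k l : nat, (k <= l)%N -> dle (alpha k) (alpha l),
        disjoint_seq d
      & @p_cvg R X E p nat_directed (fun k : nat => x (alpha k) - d k) 0].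
Proof.
have e0 k : 0 < 4^-1 ^+ k.+1 :> R by rewrite exprn_gt0 // invr_gt0.
have [alpha [alphaP wn]] := up_null_small_overlaps p_norm E_ocont x_up e0.
pose w k := vinf (vabs (x (alpha k))) (\sum_(0 <= i < k) vabs (x (alpha i))).
have w0 k : 0 <= w k.
  by rewrite le_vinf vabs_ge0 vl_sum_ge0 // => i _; exact: vabs_ge0.
have [u u0 wu] :=
  geometric_dominant (fun k => Defs.ln_ge0 p_norm (w k)) wn.
have [s ss] := p_complete_geometric_series p_norm p_comp u0 wu.
(* This tail includes [w k], so it dominates every [w l] with [k <= l]. *)
pose v k := s - \sum_(0 <= i < k) w i.
have wv k l : (k <= l)%N -> w l <= v k.
  move=> kl; rewrite -(vl_leDl (\sum_(0 <= i < k) w i)) subrK.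
  apply: (p_cvg_ge p_norm ss); exists l.+1 => n /= ln.
  rewrite (big_cat_nat (leq0n k) (leq_trans kl (ltnW ln))) /= addrC.
  by rewrite vl_leD // le_sum_nat_term // kl.
have v0 k : 0 <= v k by apply: le_trans (w0 k) (wv _ _ (leqnn k)).
(* The overlap is charged to the larger index, where [vabs (x (alpha k))] is one of the summands;
   [w l] is then below both [v k] and [v l]. *)
have overlap k l : (k < l)%N ->
    vinf (vabs (x (alpha k))) (vabs (x (alpha l))) <= w l.
  move=> kl; rewrite vinfC vinf_mono //.
  by apply: (@le_sum_nat_term _ _ (fun i => vabs (x (alpha i)))) => // i;
    exact: vabs_ge0.
exists alpha, (fun k => x (alpha k) - vclip (x (alpha k)) (v k)); split=> //.
- have lt_disjoint k l : (k < l)%N ->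
      vinf (vabs (x (alpha k) - vclip (x (alpha k)) (v k)))
           (vabs (x (alpha l) - vclip (x (alpha l)) (v l))) = 0.
    move=> kl; apply: vinf_remainders_eq0 (erefl _).
      exact: le_trans (overlap _ _ kl) (wv _ _ (ltnW kl)).
    exact: le_trans (overlap _ _ kl) (wv _ _ (leqnn l)).
  move=> k l kl; have [/lt_disjoint //|/lt_disjoint|//] := ltngtP k l.
  by rewrite vinfC.
(* The difference is the truncated part, bounded by [v k], and [p (v k)] is the distance from the
   partial sum to [s], so [ss] itself supplies the dominating null net. *)
- apply: dominated_o_cvg0 ss => k; rewrite Defs.ln_ge0 //= subr0 subKr.
  rewrite (lnormBC p_norm (bigop _ _ _)) (ln_mono p_norm) //.
  by rewrite -/(v k) [leRHS]ger0_vabs ?vabs_vclip_le.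
Qed.
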